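(* Let $\eta,\sigma,c>0$, let $\Lambda\subseteq[0,\infty)$ be an interval with $m(\Lambda)<\infty$ and let $S\subset\Lambda$ be a Borel set. i) If $\Lambda\subset(0,\infty)$, then for all $\alpha\in(0,1]$ and all $x\in\Lambda$, $\mu_{\bar X}(x,S)<\infty$. ii) Otherwise, for all $x\in\Lambda$, $\mu_X(x,S)<\infty$; and for all $\alpha\in(0,1)$ and all $x\in\Lambda$, $\mu_{\bar X}(x,S)\le\infty$.
   Context: $A\circ B_t$ denotes $A_{B_t}$. The measure $m$ on $[0,\infty)$ is $m(dz)=dz+(\eta/\sigma)\delta_0(dz)$. $X^+$ is the reflecting Brownian motion on $[0,\infty)$ with generator $d^2/dx^2$ and $\gamma^+_t=\gamma^+_{t,0}$ is its local time at $0$, where $\gamma^+_{t,z}$ is the jointly continuous local time with $\int_0^t h(X^+_s)ds=\int_0^\infty h(z)\gamma^+_{t,z}dz$. For $\alpha\in(0,1)$, $H$ is an $\alpha$-stable subordinator independent of $X^+$ with $H_0=0$, $\mathbf E_0[e^{-\lambda H_t}]=e^{-t\lambda^\alpha}$; for $\alpha=1$, $H_t=t$. Put $\bar V_t=t+H\circ(\eta/\sigma)\gamma^+_t$, $\bar V^{-1}_t=\inf\{s:\bar V_s>t\}$. The process $\bar X$ is $X^+\circ\bar V^{-1}$ killed according to the multiplicative functional $\exp(-\frac c\sigma\gamma^+\circ\bar V^{-1}_t)$, i.e. $\mathbf E_x[f(\bar X_t)]=\mathbf E_x[f(X^+\circ\bar V_t^{-1})\exp(-\frac c\sigma\gamma^+\circ\bar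 V^{-1}_t)]$ (after killing it is in a cemetery state outside $[0,\infty)$). $X$ is the process $\bar X$ in the case $\alpha=1$ (elastic sticky Brownian motion). For $Y\in\{X,\bar X\}$, $\tau_Y(\Lambda)=\inf\{t:Y_t\notin\Lambda\}$, and the occupation measure is $\mu_Y(x,S)=\mathbf E_x\left[\int_0^{\tau_Y(\Lambda)}\mathbf 1_S(Y_s)\,ds\right]$, $x\in\Lambda$, $S\subset\Lambda$. The notation $\mu_{\bar X}(x,S)\le\infty$ means that this quantity is allowed to be infinite. *)

(* Defs.v *)
From HB Require Import structures.
From mathcomp Require Import all_boot all_order all_algebra.
From mathcomp Require Import all_classical all_reals all_analysis.
From mathcomp Require Import measurable_realfun.
Set Implicit Arguments.
Unset Strict Implicit.
Unset Printing Implicit Defensive.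
Import Order.TTheory GRing.Theory Num.Theory.
Import numFieldNormedType.Exports.
Local Open Scope classical_set_scope.
Local Open Scope ring_scope.

(* Processes are indexed by R; only the times t >= 0 are meaningful, and no
   hypothesis or definition below looks at negative times. *)

Section Processes.
Context {d : measure_display} {Omega : measurableType d} {R : realType}.
Variable P : probability Omega R.

(* The sigma-algebra generated by the X t, t \in I. *)
Definition process_salgebra (I : set R) (X : R -> {RV P >-> R}) :
    set (set Omega) :=
  <<s \bigcup_(t in I) preimage_set_system setT (X t) measurable >>.

(* Transition density, with respect to dy on [0, +oo[, of the reflecting
   Brownian motion with generator d^2/dx^2 (not 1/2 d^2/dx^2): the free motion
   has variance 2 t at time t, and the second term is the image charge at -x,
   so that the density is the Neumann heat kernel of u_t = u_xx, u_x(t, 0) = 0.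
   normal_pdf takes the mean and the standard deviation. *)
Definition reflecting_density (t x y : R) : R :=
  normal_pdf x (Num.sqrt (2 * t)) y + normal_pdf (- x) (Num.sqrt (2 * t)) y.

(* X is a reflecting Brownian motion started from x: a continuous Markov
   process on [0, +oo[ (with respect to its own filtration) with the above
   transition density. *)
Definition reflecting_BM (x : R) (X : R -> {RV P >-> R}) : Prop :=
  [/\ {ae P, forall w, X 0 w = x},
      {ae P, forall w, (forall t : R, 0 <= t -> 0 <= X t w) /\
                       {within `[0, +oo[, continuous (fun t : R => X t w)}} &
      forall (s t : R) (A : set Omega) (B : set R),
        0 <= s -> s < t -> process_salgebra `[0, s] X A -> measurable B ->
        P (A `&` X t @^-1` B) =
        (\int[P]_(w in A) \int[lebesgue_measure]_(y in B `&` `[0%R, +oo[)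
           (reflecting_density (t - s) (X s w) y)%:E)%E ].

(* gamma t z is the local time of X at level z up to time t. *)
Definition local_time (X : R -> {RV P >-> R}) (gamma : R -> R -> {RV P >-> R}) :
    Prop :=
  {ae P, forall w,
    {within `[0, +oo[ `*` `[0, +oo[,
      continuous (fun tz : R * R => gamma tz.1 tz.2 w)} /\
    forall (t : R) (h : R -> R), 0 <= t ->
      measurable_fun setT h -> (forall z, 0 <= h z) ->
      (\int[lebesgue_measure]_(s in `[0%R, t]) (h (X s w))%:E =
       \int[lebesgue_measure]_(z in `[0%R, +oo[) (h z * gamma t z w)%:E)%E}.

Definition stable_subordinator (alpha : R) (H : R -> {RV P >-> R}) : Prop :=
  [/\ {ae P, forall w, H 0 w = 0},
      {ae P, forall w,
        (forall s t : R, 0 <= s -> s <= t -> H s w <= H t w) /\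
        (forall s : R, 0 <= s -> (fun t : R => H t w) @ s^'+ --> H s w)},
      (forall (s t : R) (A : set Omega) (B : set R),
        0 <= s -> s <= t -> process_salgebra `[0, s] H A -> measurable B ->
        P (A `&` [set w | B (H t w - H s w)]) =
        (P A * P [set w | B (H t w - H s w)%R])%E),
      (forall (s t : R) (B : set R),
        0 <= s -> s <= t -> measurable B ->
        P [set w | B (H t w - H s w)] = P (H (t - s) @^-1` B)) &
      forall t lambda : R, 0 <= t -> 0 < lambda ->
        ('E_P[fun w => expR (- (lambda * H t w))%R] =
         (expR (- (t * lambda `^ alpha)))%:E)%E ].

Definition time_clock (alpha : R) (H : R -> {RV P >-> R}) : Prop :=
  if alpha == 1 then forall (t : R) (w : Omega), 0 <= t -> H t w = t
  else stable_subordinator alpha H.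

Definition independent_processes (X H : R -> {RV P >-> R}) : Prop :=
  forall A B : set Omega,
    process_salgebra `[0, +oo[ X A -> process_salgebra `[0, +oo[ H B ->
    P (A `&` B) = (P A * P B)%E.

Variables (gamma : R -> R -> {RV P >-> R}) (H : R -> {RV P >-> R}).

Definition Vbar (eta sigma t : R) (w : Omega) : R :=
  t + H (eta / sigma * gamma t 0 w) w.

Definition Vbar_inv (eta sigma t : R) (w : Omega) : R :=
  inf [set s : R | 0 <= s /\ t < Vbar eta sigma s w].

(* zeta is the lifetime obtained by killing with the multiplicative functional
   M_t = exp (- c/sigma gamma (Vbar_inv t)): the conditional survival
   probability P (zeta > t | X, H) is M_t. *)
Definition killing_time (eta sigma c : R) (X : R -> {RV P >-> R})
    (zeta : Omega -> \bar R) : Prop :=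
  measurable_fun setT zeta /\
  forall (t : R) (A : set Omega), 0 <= t ->
    <<s process_salgebra `[0, +oo[ X `|` process_salgebra `[0, +oo[ H >> A ->
    P (A `&` [set w | (t%:E < zeta w)%E]) =
    (\int[P]_(w in A)
       (expR (- (c / sigma * gamma (Vbar_inv eta sigma t w) 0 w)))%:E)%E.

(* None is the cemetery. *)
Definition killed_process (eta sigma : R) (X : R -> {RV P >-> R})
    (zeta : Omega -> \bar R) (t : R) (w : Omega) : option R :=
  if (t%:E < zeta w)%E then Some (X (Vbar_inv eta sigma t w) w) else None.

End Processes.

Section Occupation.
Context {d : measure_display} {Omega : measurableType d} {R : realType}.
Variables (P : probability Omega R) (Y : R -> Omega -> option R).

(* Equal to +oo when Y never leaves L; being in the cemetery is being
   outside L. *)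
Definition exit_time (L : set R) (w : Omega) : \bar R :=
  ereal_inf [set t%:E | t in [set t : R | 0 <= t /\ ~ (Some @` L) (Y t w)]].

Definition occupation (L S : set R) : \bar R :=
  (\int[P]_w \int[lebesgue_measure]_(s in
      [set s : R | (0 <= s)%R /\ s%:E < exit_time L w])
    (\1_(Some @` S) (Y s w))%:E)%E.

End Occupation.

(* All the objects under P_x, realized on an arbitrary probability space;
   law is P_x. *)
Record realization (R : realType) (eta sigma c alpha x : R) := Realization {
  disp : measure_display ;
  space : measurableType disp ;
  law : probability space R ;
  Xplus : R -> {RV law >-> R} ;
  ltime : R -> R -> {RV law >-> R} ;
  clock : R -> {RV law >-> R} ;
  lifetime : space -> \bar R ;
  Xplus_reflecting_BM : reflecting_BM x Xplus ;
  ltime_local_time : local_time Xplus ltime ;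
  clock_time_clock : time_clock alpha clock ;
  Xplus_clock_independent : independent_processes Xplus clock ;
  lifetime_killing_time : killing_time ltime clock eta sigma c Xplus lifetime }.

Arguments Xplus {R eta sigma c alpha x}.
Arguments ltime {R eta sigma c alpha x}.
Arguments clock {R eta sigma c alpha x}.
Arguments lifetime {R eta sigma c alpha x}.

Definition Xbar (R : realType) (eta sigma c alpha x : R)
    (M : realization eta sigma c alpha x) : R -> space M -> option R :=
  killed_process (ltime M) (clock M) eta sigma (Xplus M) (lifetime M).

Definition mu_Xbar (R : realType) (eta sigma c alpha x : R)
    (M : realization eta sigma c alpha x) (L S : set R) : \bar R :=
  occupation (law M) (Xbar (M := M)) L S.

(* X is the case alpha = 1 of Xbar. *)
Definition mu_X (R : realType) (eta sigma c x : R)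
    (M : realization eta sigma c 1 x) (L S : set R) : \bar R :=
  mu_Xbar M L S.

(* m(dz) = dz + (eta/sigma) delta_0(dz), for subsets of [0, +oo[. *)
Definition m_measure (R : realType) (eta sigma : R) (A : set R) : \bar R :=
  (lebesgue_measure A + (eta / sigma)%:E * \d_(0%R : R) A)%E.

(* Main.v *)
Require Import Defs.
From HB Require Import structures.
From mathcomp Require Import all_boot all_order all_algebra.
From mathcomp Require Import all_classical all_reals all_analysis.
From mathcomp Require Import measurable_realfun ring lra.
Set Implicit Arguments.
Unset Strict Implicit.
Unset Printing Implicit Defensive.
Import Order.TTheory GRing.Theory Num.Theory.
Import numFieldNormedType.Exports.
Local Open Scope classical_set_scope.
Local Open Scope ring_scope.

(** A finite mass m(L) confines the interval L to some [0, b], and the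
occupation measure of any S is at most the mean exit time from L, so it
suffices to bound that mean. Killing can only bring the exit forward, hence
everything is read off the unkilled path.

The reflecting Brownian motion is observed at integer times. From any point of
[0, b] it has, one unit of time later, a probability at least
[escape_rate b > 0] of lying in ]b, b + 1]; by the Markov property the
probability of having been in [0, b] at the times 0, ..., k decays
geometrically in k ([confined_decay]).

Let n be the first integer time at which the reflecting path is above b. The
time-changed process has left L no later than n + (eta/sigma) gamma_n:
- if L avoids the origin, the clock Vbar is the identity until the path first
  hits 0, so that the process leaves L at the hitting time of 0 or at time n,
  whichever comes first ([exit_before_origin]);
- if alpha = 1, the clock is Vbar_t = t + (eta/sigma) gamma_t, and at the time
  Vbar_n the process sits at the value of the path at time n ([exit_sticky]).

It remains to see that gamma has a bounded mean increment over a unit time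
interval, whatever happened before ([mean_local_time_increment]). The local
time at 0 is the limit of the rescaled time spent in [0, 1/n[, and the
transition density after a time r is at most r^(-1/2), which is integrable
over ]0, 1]. To use only finitely many times at once, the time integral is
dominated, by Fatou's lemma, by Riemann sums along the path; their means are
controlled by the sum of the j^(-1/2) for j <= M, at most 2 M^(1/2).

Summing the means of 1 + (eta/sigma) (gamma_(k+1) - gamma_k) over the events of
being confined up to time k gives a convergent geometric series
([mean_exit_lty]). For alpha < 1 and 0 in L the subordinator has infinite
mean, and the claim is only that the occupation measure may be infinite. *)

(** * Integrals of nonnegative functions, and lower limits *)

Section Integrals.
Local Open Scope ereal_scope.
Context d (T : measurableType d) (R : realType).
Variable mu : {measure set T -> \bar R}.
Implicit Types (D : set T) (f g : T -> \bar R).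

Import HBNNSimple.

(** The integral of a nonnegative function is a supremum over the simple
functions below it, hence monotone without any measurability: exit times and
occupation times are not known to be measurable here. *)
Lemma le_integral_ge0 D f g : (forall x, D x -> 0 <= f x) ->
  (forall x, D x -> f x <= g x) ->
  \int[mu]_(x in D) f x <= \int[mu]_(x in D) g x.
Proof.
move=> f0 fg; rewrite !ge0_integralE//; last first.
  by move=> x Dx; exact: le_trans (f0 _ Dx) (fg _ Dx).
apply: ge_ereal_sup => _ [h hf <-]; apply: ereal_sup_ubound.
exists h => //= x; apply: le_trans (hf x) _.
rewrite /patch; case: ifPn => // /[!inE]; exact: fg.
Qed.

Lemma ae_le_integral_ge0 f g : (forall x, 0 <= f x) -> (forall x, 0 <= g x) ->
  measurable_fun setT g -> {ae mu, forall x, f x <= g x} ->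
  \int[mu]_x f x <= \int[mu]_x g x.
Proof.
move=> f0 g0 mg [N [mN N0 subN]].
(* The bound is made to hold everywhere by raising g to +oo on a null set. *)
pose g' x := if x \in N then +oo else g x.
have mg' : measurable_fun setT g'.
  apply: measurable_fun_ifT => //.
  apply: (@measurable_fun_bool _ _ _ _ true).
  rewrite (_ : _ @^-1` _ = N) ?setTI//.
  by apply/seteqP; split => x /=; [exact: set_mem|exact: mem_set].
have g'0 x : 0 <= g' x by rewrite /g'; case: ifP => // _; exact: leey.
rewrite (_ : \int[mu]_x g x = \int[mu]_x g' x).
  apply: le_integral_ge0 => // x _; rewrite /g'.
  have [xN|xN] := boolP (x \in N); first exact: leey.
  apply: contrapT => fg; move/negP: xN; apply; rewrite inE; exact: subN.
apply: ge0_ae_eq_integral => //; exists N; split => // x /= Hx.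
apply: contrapT => xN; apply: Hx => _; rewrite /g'.
by rewrite memNset.
Qed.

Lemma measurable_limn_einf D (f : (T -> \bar R)^nat) :
  (forall n, measurable_fun D (f n)) ->
  measurable_fun D (fun x => limn_einf (f^~ x)).
Proof.
move=> mf; apply: measurableT_comp => //.
apply: (@measurable_fun_limn_esup _ _ _ _ (fun n x => - f n x)) => n.
exact: measurableT_comp.
Qed.

End Integrals.

Lemma ge_limn_einf (R : realType) (u : (\bar R)^nat) (c : \bar R) :
  (\forall n \near \oo, (c <= u n)%E) -> (c <= limn_einf u)%E.
Proof.
move=> [N _ hN]; rewrite limn_einf_lim; apply: lime_ge.
  exact: is_cvg_einfs.
exists N => // n /= Nn; apply: le_ereal_inf_tmp => _ [k /= nk <-].
by apply: hN => /=; exact: leq_trans nk.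
Qed.

Lemma limn_einf_le (R : realType) (u : (\bar R)^nat) (c : \bar R) :
  (\forall n \near \oo, (u n <= c)%E) -> (limn_einf u <= c)%E.
Proof.
move=> [N _ hN]; rewrite limn_einf_lim; apply: lime_le.
  exact: is_cvg_einfs.
exists 0%N => // n _; apply: ge_ereal_inf.
exists (u (maxn n N)); last exact: (hN (maxn n N) (leq_maxr n N)).
by exists (maxn n N) => //=; exact: leq_maxl.
Qed.

Lemma le_limn_einf (R : realType) (u v : (\bar R)^nat) :
  (forall n, (u n <= v n)%E) -> (limn_einf u <= limn_einf v)%E.
Proof.
move=> uv; rewrite !limn_einf_lim; apply: lee_lim; try exact: is_cvg_einfs.
near=> n; apply: le_ereal_inf_tmp => _ [k /= nk <-].
by apply: ge_ereal_inf; exists (u k) => //; exists k.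
Unshelve. all: by end_near. Qed.

(** * Bounds on the Neumann heat kernel *)

Section HeatKernel.
Context {R : realType}.
Implicit Types t x y b : R.

Lemma reflecting_density_ge0 t x y : 0 <= reflecting_density t x y.
Proof. by rewrite addr_ge0// normal_pdf_ge0. Qed.

Lemma reflecting_density_le t x y : 0 < t ->
  reflecting_density t x y <= (Num.sqrt t)^-1.
Proof.
move=> t0; have st0 : Num.sqrt (2 * t) != 0.
  by rewrite gt_eqF// sqrtr_gt0 mulr_gt0.
apply: le_trans (lerD (normal_pdf_ub _ _ st0) (normal_pdf_ub _ _ st0)) _.
rewrite /normal_peak sqr_sqrtr ?mulr_ge0 ?(ltW t0)//.
have -> : 2 * t * pi *+ 2 = 2 ^+ 2 * (pi * t) by ring.
rewrite sqrtrM ?sqr_ge0// sqrtr_sqr ger0_norm// invfM -mulrDl.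
rewrite (_ : 2^-1 + 2^-1 = 1 :> R) ?mul1r; last by lra.
rewrite lef_pV2 ?posrE ?sqrtr_gt0 ?mulr_gt0 ?pi_gt0//.
have := pi_ge2 R => pi2; apply: ler_wsqrtr; rewrite ler_peMl ?(ltW t0)//; lra.
Qed.

(** The Gaussian term alone gives, at time 1, the smallest density for the
largest possible displacement b + 1 from [0, b] into [b, b + 1]. *)
Definition escape_rate b : R := normal_pdf 0 (Num.sqrt (2 * 1)) (b + 1).

Lemma escape_rate_gt0 b : 0 < escape_rate b.
Proof.
have s0 : Num.sqrt (2 * 1) != 0 :> R by rewrite gt_eqF// sqrtr_gt0 mulr_gt0.
by rewrite /escape_rate normal_pdfE// mulr_gt0 ?normal_peak_gt0// expR_gt0.
Qed.

Lemma escape_rate_le1 b : escape_rate b <= 1.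
Proof.
have := @reflecting_density_le 1 0 (b + 1) ltr01.
rewrite sqrtr1 invr1 /reflecting_density -/(escape_rate b).
by apply: le_trans; rewrite ler_wpDr ?normal_pdf_ge0.
Qed.

Lemma reflecting_density_ge b x y : 0 <= x <= b -> b <= y <= b + 1 ->
  escape_rate b <= reflecting_density 1 x y.
Proof.
move=> /andP[x0 xb] /andP[by_ yb].
have s0 : Num.sqrt (2 * 1) != 0 :> R by rewrite gt_eqF// sqrtr_gt0 mulr_gt0.
rewrite /reflecting_density ler_wpDr ?normal_pdf_ge0//.
rewrite /escape_rate !normal_pdfE// ler_wpM2l ?normal_peak_ge0//.
rewrite ler_expR ler_wpM2r ?invr_ge0 ?mulrn_wge0 ?sqr_ge0// lerN2.
by rewrite subr0 lerXn2r ?nnegrE; lra.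
Qed.

End HeatKernel.

(** * Exit of the reflecting Brownian motion from [0, b] *)

Section ReflectingBM.
Context d (Omega : measurableType d) (R : realType) (P : probability Omega R).
Variables (x : R) (X : R -> {RV P >-> R}).
Hypothesis HX : reflecting_BM x X.

Lemma measurable_process_salgebra (I : set R) (Y : R -> {RV P >-> R})
    (A : set Omega) : process_salgebra I Y A -> measurable A.
Proof.
apply: smallest_sub; first exact: sigma_algebra_measurable.
by move=> _ [t _ [B mB <-]]; exact: measurable_funP.
Qed.

Definition confined (b : R) (k : nat) : set Omega :=
  \bigcap_(j in [set j | (j <= k)%N]) X j%:R @^-1` `[0, b].

Lemma confined_salgebra b k : process_salgebra `[0, k%:R] X (confined b k).
Proof.
pose G := \bigcup_(t in `[0, k%:R]%classic)
  preimage_set_system setT (X t) measurable.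
suff : measurable (confined b k : set (g_sigma_algebraType G)) by [].
apply: bigcap_measurable; first by exists 0%N.
move=> j /= jk; apply: sub_sigma_algebra; exists j%:R.
  by rewrite /= in_itv/= ler0n ler_nat.
by exists `[0, b]%classic; rewrite ?setTI.
Qed.

Lemma measurable_confined b k : measurable (confined b k).
Proof. apply: measurable_process_salgebra; exact: confined_salgebra. Qed.

Lemma confinedS b k : confined b k.+1 =
  confined b k `&` X k.+1%:R @^-1` `[0, b].
Proof.
apply/seteqP; split=> w.
  move=> h; split; last exact: (h k.+1 (leqnn _)).
  by move=> j /= jk; apply: h; exact: leqW.
move=> [h1 h2] j /=; rewrite leq_eqVlt => /orP[/eqP->//|]; exact: h1.
Qed.

Lemma confined_escape b k : 0 <= b ->
  ((escape_rate b)%:E * P (confined b k) <=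
   P (confined b k `&` X k.+1%:R @^-1` `]b, (b + 1)%R]))%E.
Proof.
move=> b0; have [_ _ markov] := HX.
have mA := measurable_confined b k.
have kk1 : k%:R < k.+1%:R :> R by rewrite ltr_nat.
rewrite (markov _ _ _ _ _ kk1)//; last exact: confined_salgebra.
rewrite -(@integral_cst _ _ _ P _ mA); apply: le_integral_ge0 => w Aw.
  by rewrite lee_fin ltW ?escape_rate_gt0.
have -> : k.+1%:R - k%:R = 1 :> R by rewrite -natrB ?subSnn.
have Xw : 0 <= X k%:R w <= b by have /= := Aw k (leqnn k); rewrite in_itv.
have -> : `]b, (b + 1)]%classic `&` `[0, +oo[%classic = `]b, (b + 1)]%classic.
  by apply: setIidl => y /=; rewrite !in_itv/= andbT; lra.
have -> : cst (escape_rate b)%:E w =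
    (\int[lebesgue_measure]_(y in `]b, (b + 1)%R]) (escape_rate b)%:E)%E.
  rewrite integral_cst//= lebesgue_measure_itv/= lte_fin ltrDl ltr01.
  by rewrite -EFinD addrAC subrr add0r mule1.
apply: le_integral_ge0 => y; first by rewrite lee_fin ltW ?escape_rate_gt0.
rewrite /= in_itv/= => /andP[? ?]; rewrite lee_fin.
by apply: reflecting_density_ge => //; lra.
Qed.

Lemma confined_decay b k : 0 <= b ->
  (P (confined b k) <= ((1 - escape_rate b) ^+ k)%:E)%E.
Proof.
move=> b0; elim: k => [|k IH].
  by rewrite expr0; exact: probability_le1 (measurable_confined b 0).
have mA := measurable_confined b; have := confined_escape k b0.
set E := confined b k `&` _ => hE.
have mE : measurable E.
  apply: measurableI => //; rewrite -[X in measurable X]setTI.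
  exact: measurable_funP.
have dis : (P (confined b k.+1) + P E <= P (confined b k))%E.
  rewrite -measureU//; last first.
    rewrite confinedS; apply/seteqP; split=> // w [[_ +] [_ +]] /=.
    by rewrite /preimage/= !in_itv/=; lra.
  apply: le_measure; rewrite ?inE//; first exact: measurableU.
  by rewrite confinedS => w [[]|[]].
have fin k' : P (confined b k') \is a fin_num by rewrite fin_num_measure.
have finE : P E \is a fin_num by rewrite fin_num_measure.
move: IH hE dis; rewrite -(fineK (fin k)) -(fineK (fin k.+1)) -(fineK finE).
rewrite -EFinM -EFinD !lee_fin exprSr => IH hE dis.
have := escape_rate_le1 b.
have : fine (P (confined b k)) * (1 - escape_rate b) <=
    (1 - escape_rate b) ^+ k * (1 - escape_rate b).
  by rewrite ler_wpM2r// subr_ge0 escape_rate_le1.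
by lra.
Qed.

End ReflectingBM.

(** * Local time at the origin along one path *)

Section Path.
Context {R : realType}.
Implicit Types (x : R -> R) (l : R -> R -> R).

(** The almost sure properties of a path and its local time that are used, so
that the arguments on one path are free of probability. *)
Definition regular_path x l : Prop :=
  [/\ forall t, 0 <= t -> 0 <= x t,
      {within `[0, +oo[, continuous x},
      {within `[0, +oo[ `*` `[0, +oo[,
        continuous (fun tz : R * R => l tz.1 tz.2)} &
      forall (t : R) (h : R -> R), 0 <= t ->
        measurable_fun setT h -> (forall z, 0 <= h z) ->
        (\int[lebesgue_measure]_(s in `[0%R, t]) (h (x s))%:E =
         \int[lebesgue_measure]_(z in `[0%R, +oo[) (h z * l t z)%:E)%E].

Variables (x : R -> R) (l : R -> R -> R).
Hypothesis xl : regular_path x l.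

Let x_ge0 t : 0 <= t -> 0 <= x t. Proof. by case: xl => + _ _ _; apply. Qed.
Let x_cont : {within `[0, +oo[, continuous x}. Proof. by case: xl. Qed.
Let l_cont : {within `[0, +oo[ `*` `[0, +oo[,
  continuous (fun tz : R * R => l tz.1 tz.2)}. Proof. by case: xl. Qed.

(** An approximation of the Dirac mass at 0 on the half-line: its integral over
[0, +oo[ is 1. *)
Definition approx_delta (n : nat) (z : R) : R :=
  n.+1%:R * \1_(`[0, n.+1%:R^-1[%classic) z.

Lemma approx_delta_ge0 n z : 0 <= approx_delta n z.
Proof. by rewrite mulr_ge0. Qed.

Lemma measurable_approx_delta n : measurable_fun setT (approx_delta n).
Proof. by apply: measurable_funM => //; exact: measurable_indic. Qed.

Lemma path_near t : 0 <= t -> forall e, 0 < e ->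
  exists2 dl, 0 < dl & forall s, 0 <= s -> `|t - s| < dl -> `|x t - x s| < e.
Proof.
move=> t0 e e0; move/subspace_continuousP : x_cont => /(_ t).
rewrite /= in_itv/= t0 => /(_ isT)/cvgrPdist_lt/(_ e e0).
rewrite near_withinE => -[dl /= dl0 H]; exists dl => // s s0 sdl.
by apply: (H s) => //=; rewrite in_itv/= s0.
Qed.

Lemma local_time_near t z : 0 <= t -> 0 <= z -> forall e, 0 < e ->
  exists2 dl, 0 < dl &
    forall y, 0 <= y -> `|z - y| < dl -> `|l t z - l t y| < e.
Proof.
move=> t0 z0 e e0; move/subspace_continuousP : l_cont => /(_ (t, z)).
rewrite /= !in_itv/= t0 z0 => /(_ (conj isT isT))/cvgrPdist_lt/(_ e e0).
rewrite near_withinE => -[[A B] /= [[a a0 Aa] [b b0 Bb]] H].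
exists b => // y y0 yb; apply: (H (t, y)) => /=.
  by split; [apply: Aa; rewrite /ball_/= subrr normr0|exact: Bb].
by split; rewrite /= in_itv/= ?t0 ?y0.
Qed.

Lemma measurable_path (t : R) : measurable_fun `[(0 : R), t] x.
Proof.
have mx : measurable_fun `[(0 : R), +oo[ x.
  exact: subspace_continuous_measurable_fun.
by apply: measurable_funS mx => // s /=; rewrite !in_itv/= andbT => /andP[].
Qed.

Lemma measurable_local_time (t : R) :
  0 <= t -> measurable_fun `[(0 : R), +oo[ (l t).
Proof.
move=> t0; apply: subspace_continuous_measurable_fun => //.
apply/subspace_continuousP => z /=; rewrite in_itv/= andbT => z0.
apply/cvgrPdist_lt => e e0; have [dl dl0 H] := local_time_near t0 z0 e0.
rewrite near_withinE; exists dl => // y /= yz; rewrite in_itv/= andbT => y0.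
exact: H.
Qed.

Definition occupation0 (n : nat) (t : R) : \bar R :=
  (\int[lebesgue_measure]_(s in `[0%R, t]) (approx_delta n (x s))%:E)%E.

(** By the occupation formula, [occupation0 n t] is the average of the local
time over the levels in [0, 1/(n+1)[, so it tends to the local time at 0. *)
Lemma occupation0_approx t : 0 <= t -> forall e, 0 < e ->
  \forall n \near \oo,
    ((l t 0 - e)%:E <= occupation0 n t <= (l t 0 + e)%:E)%E.
Proof.
move=> t0 e e0; have [dl dl0 H] := local_time_near t0 (lexx 0) e0.
near=> n.
pose I := `[0, n.+1%:R^-1[%classic : set R.
have mI : measurable I by exact: measurable_itv.
have n0 : 0 < n.+1%:R^-1 :> R by rewrite invr_gt0.
have muI : (lebesgue_measure I = n.+1%:R^-1%:E :> \bar R)%E.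
  by rewrite lebesgue_measure_itv/= lte_fin n0 oppr0 adde0.
have near_l z : I z -> l t 0 - e <= l t z <= l t 0 + e.
  rewrite /I/= in_itv/= => /andP[z0 zn].
  have ndl : n.+1%:R^-1 < dl.
    by near: n; exact: (near_infty_natSinv_lt (PosNum dl0)).
  have := H z z0; rewrite sub0r normrN ger0_norm//.
  by move=> /(_ (lt_trans zn ndl)); rewrite ltr_norml; lra.
have mlI : measurable_fun I (l t).
  apply: measurable_funS (measurable_local_time t0) => //.
  by move=> z; rewrite /I/= !in_itv/= => /andP[-> _].
have -> : occupation0 n t =
    (\int[lebesgue_measure]_(z in I) (n.+1%:R * l t z)%:E)%E.
  have [_ _ _ occupation_formula] := xl.
  rewrite /occupation0 occupation_formula//; last 2 first.
  - exact: measurable_approx_delta.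
  - exact: approx_delta_ge0.
  rewrite [RHS]integral_mkcond [LHS]integral_mkcond; apply: eq_integral => z _.
  rewrite /patch; have [zI|zI] := boolP (z \in I).
    rewrite ifT; last by move: zI; rewrite !inE /I/= !in_itv/= => /andP[-> _].
    by rewrite /approx_delta indicE zI mulr1.
  by case: ifP => // _; rewrite /approx_delta indicE (negbTE zI) mulr0 mul0r.
have cstI (r : R) : (r%:E = \int[lebesgue_measure]_(z in I) (n.+1%:R * r)%:E)%E.
  rewrite integral_cst//= muI -EFinM; congr _%:E.
  by rewrite mulrAC divff ?mul1r// gt_eqF.
have intc (r : R) : lebesgue_measure.-integrable I (EFin \o cst (n.+1%:R * r)).
  apply: measurable_bounded_integrable => //; first by rewrite /= muI ltry.
  exists `|n.+1%:R * r|; split => [|M rM]; first exact: num_real.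
  by move=> z _ /=; exact: ltW.
have intl : lebesgue_measure.-integrable I (EFin \o (fun z => n.+1%:R * l t z)).
  apply: measurable_bounded_integrable => //; first by rewrite /= muI ltry.
    exact: measurable_funM.
  exists (n.+1%:R * (`|l t 0| + e)); split => [|M rM]; first exact: num_real.
  move=> z Iz /=.
  apply: le_trans (ltW rM); rewrite normrM ger0_norm// ler_wpM2l//.
  have := near_l z Iz; rewrite ler_norml.
  by have := ler_norm (l t 0); have := ler_norm (- l t 0); rewrite normrN; lra.
apply/andP; split.
  rewrite [X in (X <= _)%E]cstI; apply: le_integral => //; first exact: intc.
  move=> z; rewrite inE => Iz; rewrite lee_fin ler_wpM2l//.
  by have /andP[] := near_l z Iz.
rewrite [X in (_ <= X)%E]cstI; apply: le_integral => //; first exact: intc.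
move=> z; rewrite inE => Iz; rewrite lee_fin ler_wpM2l//.
by have /andP[] := near_l z Iz.
Unshelve. all: by end_near. Qed.


Lemma occupation0_itv n s t : 0 <= s -> s <= t ->
  (occupation0 n t = occupation0 n s +
   \int[lebesgue_measure]_(r in `]s, t]) (approx_delta n (x r))%:E)%E.
Proof.
move=> s0 st; rewrite /occupation0.
have U : `[(0 : R), t]%classic = `[(0 : R), s]%classic `|` `]s, t]%classic.
  apply/seteqP; split=> r /=; rewrite !in_itv/=.
    by move=> /andP[r0 rt]; have [rs|rs] := leP r s; [left|right]; lra.
  by move=> [|]; lra.
rewrite U ge0_integral_setU//=.
- rewrite -U; apply/measurable_EFinP; apply: measurableT_comp.
    exact: measurable_approx_delta.
  exact: measurable_path.
- by move=> r _; rewrite lee_fin approx_delta_ge0.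
- by apply/disj_setPS => r [] /=; rewrite !in_itv/=; lra.
Qed.

Lemma local_time_le s t : 0 <= s -> s <= t -> l s 0 <= l t 0.
Proof.
move=> s0 st; apply/ler_addgt0Pr => e e0.
have e20 : 0 < e / 2 by rewrite divr_gt0.
near \oo => n.
have /andP[_ h1] : ((l t 0 - e / 2)%:E <= occupation0 n t <=
    (l t 0 + e / 2)%:E)%E.
  by near: n; exact: (occupation0_approx (le_trans s0 st) e20).
have /andP[h2 _] : ((l s 0 - e / 2)%:E <= occupation0 n s <=
    (l s 0 + e / 2)%:E)%E.
  by near: n; exact: (occupation0_approx s0 e20).
have : (occupation0 n s <= occupation0 n t)%E.
  rewrite (occupation0_itv n s0 st) leeDl//; apply: integral_ge0 => r _.
  by rewrite lee_fin approx_delta_ge0.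
by move=> /(le_trans h2) /le_trans -/(_ _ h1); rewrite lee_fin; lra.
Unshelve. all: by end_near. Qed.

Lemma local_time0 : l 0 0 = 0.
Proof.
have o0 n : occupation0 n 0 = 0%E.
  by rewrite /occupation0 set_itv1 integral_set1.
suff H e : 0 < e -> `|l 0 0| <= e.
  apply/eqP; rewrite -normr_eq0 eq_le normr_ge0 andbT.
  by apply/ler_addgt0Pr => e e0; rewrite add0r H.
move=> e0; have [N _ /(_ N (leqnn N))] := occupation0_approx (lexx 0) e0.
by rewrite /= o0 !lee_fin ler_norml; lra.
Qed.

Lemma local_time_ge0 t : 0 <= t -> 0 <= l t 0.
Proof.
by move=> t0; have := local_time_le (lexx 0) t0; rewrite local_time0.
Qed.

(** A path that is positive on a compact interval stays away from 0 there, so it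
spends no time at small levels. *)
Lemma local_time_pos t : 0 <= t -> (forall s, 0 <= s <= t -> 0 < x s) ->
  l t 0 = 0.
Proof.
move=> t0 xpos.
have [c + cmin] : exists2 c, c \in `[0, t]%R &
    forall s, s \in `[0, t]%R -> x c <= x s.
  apply: EVT_min => //; apply: continuous_subspaceW x_cont.
  by move=> s /=; rewrite !in_itv/= andbT => /andP[].
rewrite in_itv/= => /xpos xc0.
apply/eqP; rewrite eq_le local_time_ge0// andbT.
apply/ler_addgt0Pr => e e0; rewrite add0r.
near \oo => n.
have : ((l t 0 - e)%:E <= occupation0 n t <= (l t 0 + e)%:E)%E.
  by near: n; exact: (occupation0_approx t0 e0).
suff -> : occupation0 n t = 0%E by rewrite !lee_fin; lra.
rewrite /occupation0 integral0_eq// => s /=; rewrite in_itv/= => st.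
rewrite /approx_delta indicE memNset ?mulr0//= in_itv/=.
move=> /andP[_]; apply/negP; rewrite -leNgt.
apply: le_trans (cmin s st); apply: ltW.
by near: n; exact: (near_infty_natSinv_lt (PosNum xc0)).
Unshelve. all: by end_near. Qed.

(** The right endpoints s + (j+1)/(N+1) are used, so that s itself, at which the
density of the path given its past is not bounded, is never visited. *)
Definition riemann_sum (n : nat) (s : R) (N : nat) : R :=
  \sum_(j < N.+1) N.+1%:R^-1 * approx_delta n (x (s + j.+1%:R / N.+1%:R)).

Definition grid_cell (s : R) (N j : nat) : set R :=
  `]s + j%:R / N.+1%:R, s + j.+1%:R / N.+1%:R]%classic.

Let grid_fun n s N r : \bar R :=
  (\sum_(j < N.+1) (approx_delta n (x (s + j.+1%:R / N.+1%:R)))%:E *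
    (\1_(grid_cell s N j) r)%:E)%E.

Let grid_fun_ge0 n s N r : (0 <= grid_fun n s N r)%E.
Proof.
by apply: sume_ge0 => j _; rewrite mule_ge0// lee_fin approx_delta_ge0.
Qed.

Let measurable_grid_fun n s N : measurable_fun setT (grid_fun n s N).
Proof.
apply: emeasurable_sum => j; apply: emeasurable_funM => //.
by apply/measurable_EFinP; apply: measurable_indic; exact: measurable_itv.
Qed.

Let integral_grid_fun n s N t :
  (\int[lebesgue_measure]_(r in `]s, t]) grid_fun n s N r <=
   (riemann_sum n s N)%:E)%E.
Proof.
rewrite /grid_fun ge0_integral_sum//; last 2 first.
- move=> j; apply: emeasurable_funM => //; apply/measurable_EFinP.
  by apply: measurable_indic; exact: measurable_itv.
- by move=> j r _; rewrite mule_ge0// lee_fin approx_delta_ge0.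
rewrite /riemann_sum -sumEFin; apply: lee_sum => j _.
have mC : measurable (grid_cell s N j) by exact: measurable_itv.
have mind : measurable_fun `]s, t]
    (fun r => (\1_(grid_cell s N j) r)%:E : \bar R).
  by apply/measurable_EFinP; exact: measurable_indic.
rewrite ge0_integralZl ?lee_fin ?approx_delta_ge0//.
rewrite muleC (EFinM N.+1%:R^-1); apply: lee_wpmul2r.
  by rewrite lee_fin approx_delta_ge0.
rewrite integral_indic//=.
apply: (@le_trans _ _ (lebesgue_measure (grid_cell s N j))).
  by apply: le_measure; rewrite ?inE//; exact: measurableI.
rewrite /grid_cell lebesgue_measure_itv/= lte_fin ltrD2l ltr_pM2r ?invr_gt0//.
rewrite ltr_nat ltnSn -EFinD lee_fin opprD addrACA subrr add0r -mulrBl.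
by rewrite -natrB// subSnn mul1r.
Qed.

(** The level set [0, 1/(n+1)[ is open in the half-line and the path is
continuous, so the integrand is lower semicontinuous in time: it is below the
lower limit of its step approximations, and Fatou's lemma applies. *)
Lemma integral_le_riemann n s : 0 <= s ->
  (\int[lebesgue_measure]_(r in `]s, (s + 1)%R]) (approx_delta n (x r))%:E <=
   limn_einf (fun N => (riemann_sum n s N)%:E))%E.
Proof.
move=> s0.
apply: (@le_trans _ _ (\int[lebesgue_measure]_(r in `]s, (s + 1)%R])
    limn_einf (fun N => grid_fun n s N r))%E); last first.
  have mg N : measurable_fun `]s, (s + 1)%R] (grid_fun n s N).
    exact: measurable_funTS (measurable_grid_fun n s N).
  apply: le_trans; first by apply: fatou => // N r _; exact: grid_fun_ge0.
  apply: le_limn_einf => N; exact: integral_grid_fun.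
apply: le_integral_ge0 => r; first by rewrite lee_fin approx_delta_ge0.
rewrite /= in_itv/= => /andP[sr rs1].
have r0 : 0 <= r by lra.
have [xn|xn] := ltP (x r) n.+1%:R^-1; last first.
  rewrite /approx_delta indicE memNset ?mulr0/=.
    by apply: ge_limn_einf; near=> N; exact: grid_fun_ge0.
  by rewrite in_itv/= => /andP[_]; apply/negP; rewrite -leNgt.
have e0 : 0 < n.+1%:R^-1 - x r by rewrite subr_gt0.
have [dl dl0 H] := path_near r0 e0.
apply: ge_limn_einf; near=> N.
have N0 : 0 < N.+1%:R :> R by [].
have Ndl : N.+1%:R^-1 < dl.
  by near: N; exact: (near_infty_natSinv_lt (PosNum dl0)).
(* r lies in the cell of index j = ceil ((r - s) (N + 1)) - 1. *)
pose y := (r - s) * N.+1%:R.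
have [j jN /andP[jy yj]] : exists2 j : nat, (j < N.+1)%N & j%:R < y <= j.+1%:R.
  have y0 : 0 < y by rewrite mulr_gt0// subr_gt0.
  have yN : y <= N.+1%:R by rewrite -[leRHS]mul1r ler_wpM2r//; lra.
  have ex : exists m, y <= m%:R by exists N.+1.
  case: (ex_minnP ex) => -[|j] hj jmin; first by lra.
  exists j; first by rewrite -ltnS ltnS; exact: jmin.
  by rewrite hj andbT ltNge; apply/negP => /jmin; rewrite ltnn.
have rE : r = s + y / N.+1%:R by rewrite mulfK ?gt_eqF//; lra.
have cell : grid_cell s N j r.
  rewrite /grid_cell/= in_itv/= {1 2}rE ltrD2l lerD2l.
  by rewrite ltr_pM2r ?ler_pM2r ?invr_gt0// jy.
set q := s + j.+1%:R / N.+1%:R.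
have q0 : 0 <= q by rewrite addr_ge0// divr_ge0.
have rq : `|r - q| < dl.
  apply: le_lt_trans Ndl; rewrite /q {1}rE.
  rewrite opprD addrACA subrr add0r -mulrBl normrM.
  rewrite [X in _ * X]ger0_norm ?invr_ge0// ler_piMl// ?invr_ge0// ler_norml -natr1.
  by move: jy yj; rewrite -natr1; lra.
have xq := H q q0 rq.
have delta_top z : 0 <= z -> z < n.+1%:R^-1 -> approx_delta n z = n.+1%:R.
  by move=> z0 zn; rewrite /approx_delta indicE mem_set ?mulr1//= in_itv/= z0.
rewrite delta_top ?x_ge0// /grid_fun (bigD1 (Ordinal jN))//=.
have xqn : x q < n.+1%:R^-1.
  by move: xq; rewrite ltr_distlC => /andP[_]; rewrite addrC subrK.
rewrite -/q (delta_top _ (x_ge0 q0) xqn).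
rewrite indicE mem_set// mule1 leeDl//; apply: sume_ge0 => i _.
by rewrite mule_ge0// lee_fin approx_delta_ge0.
Unshelve. all: by end_near. Qed.

Lemma local_time_increment_le s : 0 <= s ->
  ((l (s + 1) 0 - l s 0)%:E <=
   limn_einf (fun n => limn_einf (fun N => (riemann_sum n s N)%:E)))%E.
Proof.
move=> s0; apply/lee_addgt0Pr => e e0.
have e20 : 0 < e / 2 by rewrite divr_gt0.
have s1 : 0 <= s + 1 by lra.
rewrite -leeBlDr// -EFinB; apply: ge_limn_einf; near=> n.
apply: le_trans (integral_le_riemann n s0).
have /andP[h1 _] : ((l (s + 1) 0 - e / 2)%:E <= occupation0 n (s + 1) <=
    (l (s + 1) 0 + e / 2)%:E)%E.
  by near: n; exact: (occupation0_approx s1 e20).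
have /andP[h3 h2] : ((l s 0 - e / 2)%:E <= occupation0 n s <=
    (l s 0 + e / 2)%:E)%E.
  by near: n; exact: (occupation0_approx s0 e20).
have ss1 : s <= s + 1 by lra.
move: h1; rewrite (occupation0_itv n s0 ss1).
move=> /le_trans /(_ (leeD2r _ h2)).
rewrite addeC -leeBlDr// -EFinB; apply: le_trans.
by rewrite lee_fin; lra.
Unshelve. all: by end_near. Qed.

End Path.

(** * Mean increment of the local time *)

(** Each term satisfies 1 / sqrt (j+1) <= 2 (sqrt (j+1) - sqrt j), and the right
sides telescope. *)
Lemma sum_invsqrt (R : realType) (M : nat) :
  \sum_(j < M) (Num.sqrt j.+1%:R)^-1 <= 2 * Num.sqrt M%:R :> R.
Proof.
elim: M => [|M IH]; first by rewrite big_ord0 sqrtr0 mulr0.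
rewrite big_ord_recr/=; apply: le_trans (lerD IH (lexx _)) _.
set a := Num.sqrt M%:R; set c := Num.sqrt M.+1%:R.
have c0 : 0 < c by rewrite sqrtr_gt0.
have a0 : 0 <= a by exact: sqrtr_ge0.
have ac : c ^+ 2 = a ^+ 2 + 1 by rewrite !sqr_sqrtr// natr1.
have ale : a <= c by rewrite ler_sqrt// ler_nat.
rewrite -lerBrDl -[X in X <= _]mul1r ler_pdivrMr//.
by move: ac; rewrite !expr2; nra.
Qed.

Section LocalTimeMean.
Context d (Omega : measurableType d) (R : realType) (P : probability Omega R).
Variables (x : R) (X : R -> {RV P >-> R}) (gamma : R -> R -> {RV P >-> R}).
Hypothesis HX : reflecting_BM x X.
Hypothesis Hgamma : local_time X gamma.

Lemma ae_regular_path :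
  {ae P, forall w, regular_path (X^~ w) (fun t z => gamma t z w)}.
Proof.
have [_ X_reg _] := HX.
by apply: filterS2 X_reg Hgamma => w [? ?] [? ?]; split.
Qed.

Lemma prob_near_origin (A : set Omega) (s r e : R) :
  process_salgebra `[0, s] X A -> 0 <= s -> 0 < r -> 0 <= e ->
  (P (A `&` X (s + r)%R @^-1` `[0%R, e[) <= (e / Num.sqrt r)%:E * P A)%E.
Proof.
move=> XA s0 r0 e0; have [_ _ markov] := HX.
have mA : measurable A by exact: measurable_process_salgebra XA.
have ssr : s < s + r by rewrite ltrDl.
rewrite (markov _ _ _ _ s0 ssr XA)//.
rewrite -(@integral_cst _ _ _ P _ mA); apply: le_integral_ge0 => w Aw.
  by apply: integral_ge0 => y _; rewrite lee_fin reflecting_density_ge0.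
have -> : `[0, e[%classic `&` `[0, +oo[%classic = `[0, e[%classic :> set R.
  by apply: setIidl => y /=; rewrite !in_itv/= andbT => /andP[].
rewrite addrAC subrr add0r.
have -> : cst (e / Num.sqrt r)%:E w =
    (\int[lebesgue_measure]_(y in `[0%R, e[) ((Num.sqrt r)^-1)%:E)%E.
  rewrite integral_cst//= lebesgue_measure_itv/= lte_fin.
  case: ltP => [_|e0']; first by rewrite oppr0 adde0 -EFinM mulrC.
  by rewrite (_ : e = 0) ?mul0r ?mule0//; apply/eqP; rewrite eq_le e0 e0'.
apply: le_integral_ge0 => y _; first by rewrite lee_fin reflecting_density_ge0.
by rewrite lee_fin reflecting_density_le.
Qed.

(** The factor n+1 of the approximate Dirac mass cancels the length of the
interval [0, 1/(n+1)[, so the bound is uniform in n as well as in N. *)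
Lemma mean_riemann_sum (A : set Omega) (s : R) (n N : nat) :
  process_salgebra `[0, s] X A -> 0 <= s ->
  (\int[P]_(w in A) (riemann_sum (X^~ w) n s N)%:E <= 2%:E * P A)%E.
Proof.
move=> XA s0; have mA : measurable A by exact: measurable_process_salgebra XA.
pose B := `[0, n.+1%:R^-1[%classic : set R.
have mB : measurable B by exact: measurable_itv.
have mXB t : measurable (X t @^-1` B).
  by rewrite -[X in measurable X]setTI; exact: measurable_funP.
have -> : (\int[P]_(w in A) (riemann_sum (X^~ w) n s N)%:E =
    \int[P]_(w in A) \sum_(j < N.+1) (n.+1%:R / N.+1%:R)%R%:E *
      (\1_(X (s + j.+1%:R / N.+1%:R)%R @^-1` B) w)%:E)%E.
  apply: eq_integral => w _; rewrite /riemann_sum -sumEFin.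
  apply: eq_bigr => j _.
  by rewrite -EFinM /approx_delta mulrA [_^-1 * _]mulrC.
have mind t : measurable_fun A (fun w => (\1_(X t @^-1` B) w)%:E : \bar R).
  by apply/measurable_EFinP; exact: measurable_indic.
rewrite ge0_integral_sum//; last by move=> j; apply: emeasurable_funM.
under eq_bigr do rewrite ge0_integralZl ?lee_fin ?divr_ge0// integral_indic//.
have [p p0 PA] : exists2 p, 0 <= p & P A = p%:E.
  by exists (fine (P A)); rewrite ?fine_ge0// fineK// fin_num_measure.
rewrite PA -EFinM.
apply: (@le_trans _ _ (\sum_(j < N.+1)
    ((Num.sqrt N.+1%:R)^-1 * (Num.sqrt j.+1%:R)^-1 * p)%:E)%E).
  apply: lee_sum => j _; rewrite setIC.
  have r0 : 0 < j.+1%:R / N.+1%:R :> R by rewrite divr_gt0.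
  have n0 : 0 <= n.+1%:R^-1 :> R by rewrite invr_ge0.
  have nN : (0 <= (n.+1%:R / N.+1%:R : R)%:E)%E by rewrite lee_fin divr_ge0.
  apply: le_trans (lee_wpmul2l nN (prob_near_origin XA s0 r0 n0)) _.
  rewrite PA -!EFinM lee_fin mulrA ler_wpM2r// le_eqVlt; apply/orP; left.
  rewrite sqrtrM// sqrtrV// invfM invrK.
  rewrite -[in X in n.+1%:R / X](@sqr_sqrtr _ N.+1%:R)//.
  by apply/eqP; field; rewrite ?gt_eqF ?sqrtr_gt0.
rewrite sumEFin lee_fin -mulr_suml ler_wpM2r// -mulr_sumr.
by rewrite mulrC ler_pdivrMr ?sqrtr_gt0// sum_invsqrt.
Qed.

Lemma measurable_riemann_sum n s N :
  measurable_fun setT (fun w => riemann_sum (X^~ w) n s N).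
Proof.
apply: measurable_sum => j; apply: measurable_funM => //.
by apply: measurableT_comp => //; exact: measurable_approx_delta.
Qed.

(** Fatou's lemma is used twice: for the mesh of the Riemann sums, then for the
width of the interval around the origin. *)
Lemma mean_local_time_increment (A : set Omega) (s : R) :
  process_salgebra `[0, s] X A -> 0 <= s ->
  (\int[P]_(w in A) (`|gamma (s + 1) 0 w - gamma s 0 w|%R)%:E <= 2%:E * P A)%E.
Proof.
move=> XA s0; have mA : measurable A by exact: measurable_process_salgebra XA.
have mriem n N : measurable_fun A (fun w => (riemann_sum (X^~ w) n s N)%:E).
  apply/measurable_EFinP; apply: measurable_funTS.
  exact: measurable_riemann_sum.
have riem0 n N w : (0 <= (riemann_sum (X^~ w) n s N)%:E)%E.
  by rewrite lee_fin; apply: sumr_ge0 => j _; rewrite mulr_ge0//;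
    exact: approx_delta_ge0.
have mlim n : measurable_fun A
    (fun w => limn_einf (fun N => (riemann_sum (X^~ w) n s N)%:E)).
  exact: measurable_limn_einf.
have lim0 n w : (0 <= limn_einf (fun N => (riemann_sum (X^~ w) n s N)%:E))%E.
  by apply: ge_limn_einf; near=> N.
apply: (@le_trans _ _ (\int[P]_(w in A) limn_einf (fun n =>
    limn_einf (fun N => (riemann_sum (X^~ w) n s N)%:E)))%E).
  apply: ae_ge0_le_integral => //.
  - apply/measurable_EFinP; apply: measurable_funTS.
    by apply: measurableT_comp => //; exact: measurable_funB.
  - by move=> w _; apply: ge_limn_einf; near=> n.
  - exact: measurable_limn_einf.
  - apply: filterS ae_regular_path => w rw _.
    have := local_time_increment_le rw s0; rewrite ger0_norm// subr_ge0.
    by apply: (local_time_le rw) => //; lra.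
apply: le_trans (fatou _ mA mlim (fun n w _ => lim0 n w)) _.
apply: limn_einf_le; near=> n.
apply: le_trans (fatou _ mA (mriem n) (fun N w _ => riem0 n N w)) _.
by apply: limn_einf_le; near=> N; exact: mean_riemann_sum.
Unshelve. all: by end_near. Qed.

End LocalTimeMean.

(** * Exit of the time-changed path *)

Section Exit.
Context d (Omega : measurableType d) (R : realType) (P : probability Omega R).
Variables (eta sigma : R) (X : R -> {RV P >-> R}).
Variables (gamma : R -> R -> {RV P >-> R}) (H : R -> {RV P >-> R}).
Variable zeta : Omega -> \bar R.
Hypothesis kappa_gt0 : 0 < eta / sigma.

Let Y := killed_process gamma H eta sigma X zeta.
Let tau L w := exit_time Y L w.

Section FixedPath.
Variable w : Omega.
Hypothesis path_w : regular_path (X^~ w) (fun t z => gamma t z w).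

Let gamma0_ge0 t : 0 <= t -> 0 <= gamma t 0 w.
Proof. exact: (local_time_ge0 path_w). Qed.

(** Killing cannot invalidate this: the cemetery is outside of L as well. *)
Lemma exit_time_le L s t : 0 <= t -> Vbar_inv gamma H eta sigma t w = s ->
  ~ L (X s w) -> (tau L w <= t%:E)%E.
Proof.
move=> t0 ts nL; apply: ereal_inf_lbound; exists t => //; split => // -[y Ly].
by rewrite /Y /killed_process ts; case: ifP => // _ [yE]; apply: nL; rewrite -yE.
Qed.

(** Before the path hits 0 no local time has accrued, so the clock is the
identity on [0, t[; beyond t it can only run ahead, and both facts together
pin down its inverse at t itself. *)
Lemma Vbar_inv_id t : H 0 w = 0 -> (forall s, 0 <= s -> 0 <= H s w) ->
  0 <= t -> (forall s, 0 <= s < t -> 0 < X s w) ->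
  Vbar_inv gamma H eta sigma t w = t.
Proof.
move=> H0 H_ge0 t0 Xpos; rewrite /Vbar_inv.
set E := [set s | _].
have memE s : t < s -> E s.
  move=> ts; have s0 : 0 <= s by lra.
  split => //; rewrite /Vbar.
  by have := H_ge0 _ (mulr_ge0 (ltW kappa_gt0) (gamma0_ge0 s0)); lra.
have lbE : lbound E t.
  move=> s [s0 tV]; rewrite leNgt; apply/negP => st.
  have g0 : gamma s 0 w = 0.
    apply: (local_time_pos path_w) => // r /andP[r0 rs].
    by apply: Xpos; rewrite r0 (le_lt_trans rs).
  by move: tV; rewrite /Vbar g0 mulr0 H0; lra.
apply/eqP; rewrite eq_le; apply/andP; split.
  apply/ler_addgt0Pr => e e0; apply: ge_inf; first by exists t.
  by apply: memE; rewrite ltrDl.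
by apply: lb_le_inf => //; exists (t + 1); apply: memE; rewrite ltrDl.
Qed.

(** Either the path is positive until n, and the process sits above b at time n,
or it has a first zero, at which the process sits at 0; both are outside L. *)
Lemma exit_before_origin L b n :
  H 0 w = 0 -> (forall s, 0 <= s -> 0 <= H s w) ->
  L `<=` `]0, +oo[ -> L `<=` `]-oo, b] -> b < X n%:R w ->
  (tau L w <= n%:R%:E)%E.
Proof.
move=> H0 H_ge0 Lpos Lb bX; have [X_ge0 _ _ _] := path_w.
have [hit|nohit] := pselect (exists2 s, 0 <= s < n%:R & X s w <= 0); last first.
  apply: (exit_time_le (s := n%:R)) => //; last first.
    by move=> /Lb; rewrite /= in_itv/= leNgt bX.
  apply: Vbar_inv_id => // s sn; rewrite ltNge; apply/negP => Xs.
  by apply: nohit; exists s.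
(* inf E is the first zero of the path, a zero by continuity. *)
pose E := [set s | 0 <= s /\ X s w <= 0].
have [s /andP[s0 sn] Xs] := hit.
have E0 : has_inf E by split; [exists s|exists 0 => r []].
have inf0 : 0 <= inf E by apply: lb_le_inf; [exists s|move=> r []].
have pos r : 0 <= r < inf E -> 0 < X r w.
  move=> /andP[r0 rE]; rewrite ltNge; apply/negP => Xr.
  by move: rE; rewrite ltNge ge_inf//; case: E0.
have Xinf : X (inf E) w <= 0.
  rewrite leNgt; apply/negP => Xi.
  have [dl dl0 near_i] := path_near path_w inf0 Xi.
  have : inf E + dl <= inf E.
    apply: lb_le_inf; first by exists s.
    move=> r Er; have ir : inf E <= r by apply: ge_inf => //; case: E0.
    rewrite leNgt; apply/negP => rd; case: Er => r0 Xr.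
    have : `|inf E - r| < dl by rewrite distrC ger0_norm ?subr_ge0//; lra.
    by move=> /(near_i _ r0); rewrite ltr_norml; lra.
  by lra.
have infs : inf E <= s by apply: ge_inf => //; case: E0.
apply: (@le_trans _ _ (inf E)%:E); last by rewrite lee_fin; lra.
apply: (exit_time_le (s := inf E)) => //; first exact: Vbar_inv_id.
by move=> /Lpos; rewrite /= in_itv/= andbT ltNge Xinf.
Qed.

(** The clock t + (eta/sigma) gamma_t is strictly increasing, so its inverse takes
the value n at the image of n. *)
Lemma exit_sticky L b n : (forall t, 0 <= t -> H t w = t) ->
  L `<=` `]-oo, b] -> b < X n%:R w ->
  (tau L w <= (n%:R + eta / sigma * gamma n%:R 0 w)%:E)%E.
Proof.
move=> Ht Lb bX; set v := _ + _.
have VE s : 0 <= s ->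
    Vbar gamma H eta sigma s w = s + eta / sigma * gamma s 0 w.
  by move=> s0; rewrite /Vbar Ht// mulr_ge0// ?(ltW kappa_gt0)// gamma0_ge0.
have v0 : 0 <= v by rewrite addr_ge0// mulr_ge0 ?(ltW kappa_gt0)// gamma0_ge0.
apply: (exit_time_le (s := n%:R)) => //; last first.
  by move=> /Lb; rewrite /= in_itv/= leNgt bX.
rewrite /Vbar_inv (_ : [set s | _] = `]n%:R, +oo[%classic) ?inf_itv//.
have n0 : 0 <= n%:R :> R by [].
apply/seteqP; split=> s /=; rewrite in_itv/= andbT.
  move=> [s0]; rewrite VE// !ltNge; apply: contra => sn.
  rewrite lerD// ler_wpM2l ?(ltW kappa_gt0)//.
  exact: (local_time_le path_w).
move=> ns; have s0 : 0 <= s by lra.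
split => //; rewrite VE// ltr_leD// ler_wpM2l ?(ltW kappa_gt0)//.
by apply: (local_time_le path_w) => //; exact: ltW.
Qed.

End FixedPath.

End Exit.

(** * Mean exit time *)

Section ExitMean.
Context d (Omega : measurableType d) (R : realType) (P : probability Omega R).
Variables (x : R) (X : R -> {RV P >-> R}) (gamma : R -> R -> {RV P >-> R}).
Hypothesis HX : reflecting_BM x X.
Hypothesis Hgamma : local_time X gamma.
Variables (b kappa : R).
Hypotheses (b0 : 0 <= b) (kappa0 : 0 <= kappa).

(** The real time spent while the reflecting path runs over [k, k + 1], counted
only if the path was in [0, b] at all integer times up to k. *)
Let stage (k : nat) (w : Omega) : \bar R :=
  (\1_(confined X b k) w *
    (1 + kappa * `|gamma k.+1%:R 0 w - gamma k%:R 0 w|))%:E.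

Let stage_ge0 k w : (0 <= stage k w)%E.
Proof. by rewrite lee_fin mulr_ge0// addr_ge0// mulr_ge0. Qed.

Let measurable_stage k : measurable_fun setT (stage k).
Proof.
apply/measurable_EFinP; apply: measurable_funM.
  by apply: measurable_indic; exact: measurable_confined.
apply: measurable_funD => //; apply: measurable_funM => //.
by apply: measurableT_comp => //; exact: measurable_funB.
Qed.

Let mean_stage k :
  (\int[P]_w stage k w <= ((1 + 2 * kappa) * (1 - escape_rate b) ^+ k)%:E)%E.
Proof.
have XA : process_salgebra `[0, k%:R] X (confined X b k).
  exact: confined_salgebra.
have mA := measurable_confined X b k.
set A := confined X b k in XA mA *.
have [p PA p0] : exists2 p, P A = p%:E & 0 <= p.
  by exists (fine (P A)); rewrite ?fine_ge0// fineK// fin_num_measure.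
have mg : measurable_fun A
    (fun w => (`|gamma k.+1%:R 0 w - gamma k%:R 0 w|)%:E : \bar R).
  apply/measurable_EFinP; apply: measurable_funTS; apply: measurableT_comp => //.
  exact: measurable_funB.
have -> : (\int[P]_w stage k w = \int[P]_(w in A)
    (1%:E + kappa%:E * (`|gamma k.+1%:R 0 w - gamma k%:R 0 w|)%:E))%E.
  rewrite [RHS]integral_mkcond; apply: eq_integral => w _.
  rewrite /stage /patch indicE -/A; case: ifP => _; last by rewrite mul0r.
  by rewrite mul1r EFinD EFinM.
have mkg : measurable_fun A (fun w =>
    kappa%:E * (`|gamma k.+1%:R 0 w - gamma k%:R 0 w|)%:E)%E.
  exact: emeasurable_funM.
have kg0 w : A w -> (0 <=
    kappa%:E * (`|gamma k.+1%:R 0 w - gamma k%:R 0 w|)%:E)%E.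
  by rewrite mule_ge0.
rewrite ge0_integralD//.
rewrite integral_cst// mul1e ge0_integralZl//.
have := mean_local_time_increment HX Hgamma XA (ler0n _ _).
rewrite natr1 PA => inc; have := confined_decay HX k b0.
rewrite -/A PA lee_fin => dec.
apply: (@le_trans _ _ (p%:E + kappa%:E * (2%:E * p%:E))%E).
  have PAle : (P A <= p%:E)%E by rewrite PA.
  by apply: leeD; [exact: PAle|exact: lee_wpmul2l].
have -> : (p%:E + kappa%:E * (2%:E * p%:E) = ((1 + 2 * kappa) * p)%:E)%E.
  by rewrite -!EFinM -EFinD; congr _%:E; ring.
rewrite lee_fin.
by rewrite ler_wpM2l// addr_ge0// mulr_ge0.
Qed.

(** Almost surely T is below the sum of all stages: the stages before the first
integer n with a position above b telescope to n + kappa gamma_n, and if there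
is no such n then every stage is at least 1 and the sum is infinite. *)
Lemma mean_exit_lty (T : Omega -> \bar R) : (forall w, 0 <= T w)%E ->
  {ae P, forall w, forall n : nat, b < X n%:R w ->
    (T w <= (n%:R + kappa * gamma n%:R 0 w)%:E)%E} ->
  (\int[P]_w T w < +oo)%E.
Proof.
move=> T0 HT; set r := 1 - escape_rate b.
have r01 : `|r| < 1.
  have := escape_rate_gt0 b; have := escape_rate_le1 b.
  by rewrite /r ltr_norml; lra.
have r0 : 0 <= r by rewrite subr_ge0 escape_rate_le1.
apply: (@le_lt_trans _ _ (\int[P]_w \sum_(0 <= k <oo) stage k w)%E).
  apply: ae_le_integral_ge0 => //.
  - by move=> w; apply: nneseries_ge0 => k _ _.
  - by apply: ge0_emeasurable_sum => // k w _ _.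
  - apply: filterS2 HT (ae_regular_path HX Hgamma).
    move=> w Tw path_w.
    have [all_in|] := pselect (forall k, confined X b k w).
      rewrite (_ : (\sum_(0 <= k <oo) stage k w)%E = +oo%E) ?leey//.
      apply/eqyP => M M0; near \oo => N.
      apply: (@le_trans _ _ (\sum_(0 <= k < N) stage k w)%E); last first.
        exact: nneseries_lim_ge.
      apply: (@le_trans _ _ (\sum_(0 <= k < N) 1%:E)%E).
        rewrite sumEFin lee_fin sumr_const_nat subn0.
        by near: N; exact: nbhs_infty_ger.
      apply: lee_sum => k _; rewrite /stage indicE mem_set// mul1r lee_fin.
      by rewrite lerDl mulr_ge0.
    move=> /existsNP exitn.
    have ex : exists n, ~~ `[< confined X b n w >].
      by have [n hn] := exitn; exists n; apply/asboolPn.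
    case: (ex_minnP ex) => n /asboolPn nA nmin.
    have conf k : (k < n)%N -> confined X b k w.
      by move=> kn; apply: contrapT => /asboolPn /nmin; rewrite leqNgt kn.
    have Xn : b < X n%:R w.
      have [X_ge0 _ _ _] := path_w.
      rewrite ltNge; apply/negP => Xb; apply: nA => j /=.
      rewrite leq_eqVlt => /orP[/eqP->|jn]; last exact: (conf j jn j (leqnn j)).
      by rewrite /= in_itv/= X_ge0.
    apply: le_trans (Tw n Xn) _.
    apply: le_trans; last by apply: (nneseries_lim_ge n).
    rewrite (_ : n%:R + _ = \sum_(0 <= k < n)
        (1 + kappa * (gamma k.+1%:R 0 w - gamma k%:R 0 w))).
      rewrite -sumEFin !big_mkord; apply: lee_sum => k _.
      rewrite /stage indicE mem_set; last exact: (conf k (ltn_ord k)).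
      by rewrite mul1r lee_fin lerD2l ler_wpM2l// ler_norm.
    rewrite big_split/= sumr_const_nat subn0 -mulr_sumr telescope_sumr//.
    by rewrite (local_time0 path_w) subr0.
rewrite integral_nneseries//.
apply: (@le_lt_trans _ _ (\sum_(0 <= k <oo) ((1 + 2 * kappa) * r ^+ k)%:E)%E).
  by apply: lee_nneseries => [k _ _|k _]; [exact: integral_ge0|exact: mean_stage].
suff -> : (\sum_(0 <= k <oo) ((1 + 2 * kappa) * r ^+ k)%:E)%E =
    ((1 + 2 * kappa) * (1 - r)^-1)%:E by rewrite ltry.
apply: cvg_lim => //; under eq_fun do rewrite sumEFin.
by apply: cvg_EFin; [near=> n|exact: cvg_geometric_series].
Unshelve. all: by end_near. Qed.

End ExitMean.

(** * From occupation measures to mean exit times *)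

Section Occupation.
Context d (Omega : measurableType d) (R : realType) (P : probability Omega R).

Lemma exit_time_ge0 (Y : R -> Omega -> option R) (L : set R) (w : Omega) :
  (0 <= exit_time Y L w)%E.
Proof. by apply: le_ereal_inf_tmp => _ [t [t0 _] <-]; rewrite lee_fin. Qed.

Lemma occupation_le_mean_exit (Y : R -> Omega -> option R) (L S : set R) :
  (occupation P Y L S <= \int[P]_w exit_time Y L w)%E.
Proof.
apply: le_integral_ge0 => w _.
  by apply: integral_ge0 => s _; rewrite lee_fin.
have := exit_time_ge0 Y L w.
case: (exit_time Y L w) => [r r0|_|//]; last exact: leey.
rewrite (_ : [set s | _] = `[0, r[%classic); last first.
  apply/seteqP; split=> s /=; rewrite in_itv/= lte_fin.
    by move=> [-> ->].
  by move=> /andP[].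
apply: (@le_trans _ _ (\int[lebesgue_measure]_(s in `[0%R, r[) 1%:E)%E).
  by apply: le_integral_ge0 => s _; rewrite lee_fin.
rewrite integral_cst//= mul1e lebesgue_measure_itv/= lte_fin.
by case: ifP => // _; rewrite oppr0 adde0.
Qed.

End Occupation.

Lemma finite_interval_ubound (R : realType) (L : set R) :
  is_interval L -> (lebesgue_measure L < +oo)%E -> exists b, L `<=` `]-oo, b].
Proof.
move=> itvL Lfin; apply: contrapT => /forallNP noub.
have above b : exists2 y, L y & b < y.
  have /existsNP[y /not_implyP[Ly yb]] := noub b.
  by exists y => //; move: yb; rewrite /= in_itv/= => /negP; rewrite -ltNge.
have [a La _] := above 0.
have mL : measurable L by exact: is_interval_measurable.
have Lfn : lebesgue_measure L \is a fin_num by rewrite ge0_fin_numE.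
pose M := fine (lebesgue_measure L) + 1.
have M0 : 0 < M by rewrite ltr_wpDl// fine_ge0.
have [y Ly ay] := above (a + M).
have sub : `[a, a + M]%classic `<=` L.
  move=> z /=; rewrite in_itv/= => /andP[az zM].
  by apply: (itvL a y) => //; rewrite az/= (le_trans zM)// ltW.
have : (lebesgue_measure (`[a, (a + M)%R]%classic : set R) <=
    lebesgue_measure L)%E.
  by apply: le_measure; rewrite ?inE//; exact: measurable_itv.
rewrite lebesgue_measure_itv/= lte_fin ltrDl M0 -EFinD -(fineK Lfn) lee_fin /M.
by lra.
Qed.

Lemma time_clock_nonneg d (Omega : measurableType d) (R : realType)
    (P : probability Omega R) (alpha : R) (H : R -> {RV P >-> R}) :
  time_clock alpha H ->
  {ae P, forall w, H 0 w = 0 /\ forall s, 0 <= s -> 0 <= H s w}.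
Proof.
rewrite /time_clock; case: ifP => _ => [H0|[H0 incr _ _ _]].
  by apply: nearW => w; rewrite H0//; split => // s s0; rewrite H0.
apply: filterS2 H0 incr => w Hw0 [mono _]; split => // s s0.
by rewrite -Hw0 mono.
Qed.

Lemma mean_exit_pos (R : realType) (eta sigma c alpha x b : R) (L : set R)
    (M : realization eta sigma c alpha x) :
  0 < eta / sigma -> 0 <= b -> L `<=` `]-oo, b] -> L `<=` `]0, +oo[ ->
  (\int[law M]_w exit_time (Xbar (M := M)) L w < +oo)%E.
Proof.
move=> k0 b0 Lb Lpos.
have HX := Xplus_reflecting_BM M; have Hl := ltime_local_time M.
apply: (mean_exit_lty HX Hl b0 (ltW k0)); first exact: exit_time_ge0.
apply: filterS2 (ae_regular_path HX Hl) (time_clock_nonneg (clock_time_clock M)).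
move=> w path_w [H0 H_ge0] n bX.
apply: le_trans (exit_before_origin _ k0 path_w H0 H_ge0 Lpos Lb bX) _.
by rewrite lee_fin lerDl mulr_ge0 ?(ltW k0)// (local_time_ge0 path_w).
Qed.

Lemma mean_exit_sticky (R : realType) (eta sigma c x b : R) (L : set R)
    (M : realization eta sigma c 1 x) :
  0 < eta / sigma -> 0 <= b -> L `<=` `]-oo, b] ->
  (\int[law M]_w exit_time (Xbar (M := M)) L w < +oo)%E.
Proof.
move=> k0 b0 Lb.
have HX := Xplus_reflecting_BM M; have Hl := ltime_local_time M.
have := clock_time_clock M; rewrite /time_clock eqxx => Ht.
apply: (mean_exit_lty HX Hl b0 (ltW k0)); first exact: exit_time_ge0.
apply: filterS (ae_regular_path HX Hl) => w path_w n bX.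
by apply: (exit_sticky _ k0 path_w _ Lb bX) => t; exact: Ht.
Qed.

Unset Implicit Arguments.

Theorem lemma4 (R : realType) (eta sigma c : R) (L S : set R)
  (heta : 0 < eta) (hsigma : 0 < sigma) (hc : 0 < c)
  (hL : is_interval L) (hL0 : L `<=` `[0, +oo[)
  (hmL : (m_measure eta sigma L < +oo)%E)
  (mS : measurable S) (hSL : S `<=` L) :
  (L `<=` `]0, +oo[ ->
     forall alpha : R, 0 < alpha -> alpha <= 1 -> forall x : R, L x ->
     forall M : realization eta sigma c alpha x, (mu_Xbar M L S < +oo)%E) /\
  (~ (L `<=` `]0, +oo[) ->
     (forall x : R, L x ->
      forall M : realization eta sigma c 1 x, (mu_X M L S < +oo)%E) /\
     (forall alpha : R, 0 < alpha -> alpha < 1 -> forall x : R, L x ->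
      forall M : realization eta sigma c alpha x, (mu_Xbar M L S <= +oo)%E)).
Proof.
have k0 : 0 < eta / sigma by rewrite divr_gt0.
have Lfin : (lebesgue_measure L < +oo)%E.
  by apply: le_lt_trans hmL; rewrite leeDl// mule_ge0// lee_fin ltW.
have [b Lb] := finite_interval_ubound hL Lfin.
have b_ge0 x : L x -> 0 <= b.
  move=> Lx; have := Lb _ Lx; have := hL0 _ Lx; rewrite /= !in_itv/= andbT.
  exact: le_trans.
split=> [Lpos alpha _ _ x Lx M|_]; last first.
  split=> [x Lx M|alpha _ _ x _ M]; last exact: leey.
  apply: le_lt_trans (occupation_le_mean_exit _ _ _ _) _.
  exact: mean_exit_sticky k0 (b_ge0 x Lx) Lb.
apply: le_lt_trans (occupation_le_mean_exit _ _ _ _) _.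
exact: mean_exit_pos k0 (b_ge0 x Lx) Lb Lpos.
Qed.
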